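(* Let $A \in \mathbb{R}^{n\times n}$ and $\kappa, \eta \in (0,1)$. The following statements are equivalent: (i) the linear mapping $\mathcal{A}: \mathbb{R}^n \to \mathbb{R}^n$, $x \mapsto Ax$, is $\kappa$-strictly pseudocontractive with respect to some Hilbert norm on $\mathbb{R}^n$; (ii) there exists a symmetric positive definite matrix $P \in \mathbb{R}^{n\times n}$ such that $$(1-\kappa) A^\top P A \preccurlyeq (1+\kappa) P - \kappa \left(A^\top P + P A\right);$$ (iii) the linear mapping $x \mapsto A^{\mathrm{s}}_\kappa x$, with $A^{\mathrm{s}}_\kappa := \kappa I + (1-\kappa) A$, is nonexpansive with respect to some Hilbert norm on $\mathbb{R}^n$; (iv) every eigenvalue of $A$ lies in the disk $\mathbb{D}_{\frac{1}{1-\kappa}} := \left\{ z \in \mathbb{C} : \left|z - \left(1-\tfrac{1}{1-\kappa}\right)\right| \le \tfrac{1}{1-\kappa}\right\}$, and every eigenvalue of $A$ lying on the boundary of $\mathbb{D}_{\frac{1}{1-\kappa}}$ is semi-simple; (v) the linear mapping $x \mapsto A_\alpha x$, with $A_\alpha := (1-\alpha) I + \alpha A$ and $\alpha = \eta(1-\kappa) \in (0,1)$, is $\eta$-averaged with respect to some Hilbert norm on $\mathbb{R}^n$.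
   Context: A Hilbert norm on $\mathbb{R}^n$ is a norm induced by an inner product (equivalently, of the form $\|x\|_P = \sqrt{x^\top P x}$ with $P$ symmetric positive definite). Let $\mathcal{T}:\mathbb{R}^n\to\mathbb{R}^n$ be Lipschitz continuous and $\mathrm{Id}$ the identity operator. For $\kappa \in (0,1)$, $\mathcal{T}$ is $\kappa$-strictly pseudocontractive with respect to $\|\cdot\|$ if for all $x,y \in \mathbb{R}^n$ $$\|\mathcal{T}(x)-\mathcal{T}(y)\|^2 \le \|x-y\|^2 + \kappa \,\|(\mathrm{Id}-\mathcal{T})(x) - (\mathrm{Id}-\mathcal{T})(y)\|^2 .$$ For $\eta \in (0,1)$, $\mathcal{T}$ is $\eta$-averaged with respect to $\|\cdot\|$ if for all $x,y \in \mathbb{R}^n$ $$\|\mathcal{T}(x)-\mathcal{T}(y)\|^2 \le \|x-y\|^2 - \tfrac{1-\eta}{\eta} \,\|(\mathrm{Id}-\mathcal{T})(x) - (\mathrm{Id}-\mathcal{T})(y)\|^2 .$$ $\mathcal{T}$ is nonexpansive with respect to $\|\cdot\|$ if $\|\mathcal{T}(x)-\mathcal{T}(y)\| \le \|x-y\|$ for all $x,y$. An eigenvalue of $A$ (over $\mathbb{C}$) is semi-simple if its algebraic and geometric multiplicities are equal. $X \preccurlyeq Y$ means that $Y-X$ is positive semidefinite. *)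

(* Defs.v *)
From mathcomp Require Import all_boot all_order all_algebra.
From mathcomp Require Import reals complex.

Set Implicit Arguments.
Unset Strict Implicit.
Unset Printing Implicit Defensive.

Import GRing.Theory Num.Theory.
Local Open Scope ring_scope.

Section HilbertNorm.
Variables (R : realType) (n : nat).

(* [{dot V for idfun}] is the type of symmetric, positive definite bilinear
   forms on V, i.e., of real inner products. *)
Definition hilbert_norm (f : {dot 'cV[R]_n for idfun}) (x : 'cV[R]_n) : R :=
  Num.sqrt (f x x).

Definition strictly_pseudocontractive (kappa : R) (N : 'cV[R]_n -> R)
    (T : 'cV[R]_n -> 'cV[R]_n) : Prop :=
  forall x y, N (T x - T y) ^+ 2 <=
    N (x - y) ^+ 2 + kappa * N ((x - T x) - (y - T y)) ^+ 2.

Definition averaged (eta : R) (N : 'cV[R]_n -> R)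
    (T : 'cV[R]_n -> 'cV[R]_n) : Prop :=
  forall x y, N (T x - T y) ^+ 2 <=
    N (x - y) ^+ 2 - (1 - eta) / eta * N ((x - T x) - (y - T y)) ^+ 2.

Definition nonexpansive (N : 'cV[R]_n -> R)
    (T : 'cV[R]_n -> 'cV[R]_n) : Prop :=
  forall x y, N (T x - T y) <= N (x - y).

End HilbertNorm.

Section MatrixInequality.
Variables (R : realType) (n : nat).

Definition posdefmx (P : 'M[R]_n) : Prop :=
  P \is symmetricmx /\ forall x : 'cV[R]_n, x != 0 -> 0 < (x^T *m P *m x) 0 0.

Definition possemidefmx (P : 'M[R]_n) : Prop :=
  P \is symmetricmx /\ forall x : 'cV[R]_n, 0 <= (x^T *m P *m x) 0 0.

Definition loewner_le (X Y : 'M[R]_n) : Prop := possemidefmx (Y - X).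

End MatrixInequality.

Section Eigenvalues.
Variables (F : fieldType) (n : nat).

(* The library's [eigenvalue] and [eigenspace] are about row vectors,
   v *m M = z *: v; transposing M gives M *m v = z *: v for columns v. *)
Definition col_eigenvalue (M : 'M[F]_n) (z : F) : bool := eigenvalue M^T z.

Definition alg_multiplicity (M : 'M[F]_n) (z : F) : nat := mup z (char_poly M).

Definition geom_multiplicity (M : 'M[F]_n) (z : F) : nat :=
  \rank (eigenspace M^T z).

Definition semisimple (M : 'M[F]_n) (z : F) : Prop :=
  alg_multiplicity M z = geom_multiplicity M z.

End Eigenvalues.

Section Disk.
Variable R : realType.

Definition complexmx (n : nat) (A : 'M[R]_n) : 'M[R[i]]_n :=
  map_mx (real_complex R) A.

(* The norm and the order of R[i] take values, resp. compare, in R[i]: the real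
   centre and radius are therefore embedded by %:C. *)
Definition in_disk (rho : R) (z : R[i]) : Prop :=
  `|z - (1 - rho)%:C%C| <= rho%:C%C.

Definition on_disk_boundary (rho : R) (z : R[i]) : Prop :=
  `|z - (1 - rho)%:C%C| = rho%:C%C.

End Disk.

(* Main.v *)
(* All five statements reduce to the existence of an inner product for which
   [B = kappa I + (1 - kappa) A] is nonexpansive: expanding the squares, (i),
   (ii) and (v) become [(1-kappa) |Ax|^2 <= (1+kappa) |x|^2 - 2 kappa <x, Ax>],
   which is [|Bx|^2 <= |x|^2] up to the factor [1 - kappa]. The affine map
   [z |-> kappa + (1 - kappa) z] sends the disk of (iv) onto the unit disk, so
   what remains is that B is nonexpansive for some inner product iff its
   eigenvalues lie in the closed unit disk and those on the circle are
   semi-simple, i.e. [ker (B - z)^2 = ker (B - z)].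
   For the converse direction, semi-simple eigenspaces on the circle split off
   as direct summands on which B acts by a scalar of modulus 1; when all
   eigenvalues lie strictly inside the disk, B is block triangular with a
   scalar block for one eigenspace, and rescaling that block makes the coupling
   term small. This gives a complex inner product, whose real part on R^n is
   the required one. *)

Require Import Defs.
From HB Require Import structures.
From mathcomp Require Import all_boot all_order all_algebra.
From mathcomp Require Import boolp reals complex ring lra.

Set Implicit Arguments.
Unset Strict Implicit.
Unset Printing Implicit Defensive.

Import Order.TTheory GRing.Theory Num.Theory.
Local Open Scope ring_scope.

(** * Block forms relative to an eigenspace, and characteristic polynomials *)

Lemma eqmx_usubmx_unit (F : fieldType) k g m (K : 'M[F]_(k, g + m)) :
  \rank K = g ->
  exists2 S : 'M[F]_(g + m), S \in unitmx & (usubmx S :=: K)%MS.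
Proof.
(* Gaussian elimination provides an invertible matrix whose first [\rank K] rows span the row space
   of [K]. *)
move=> rK; exists (row_ebase K); first exact: row_ebase_unit.
suff -> : usubmx (row_ebase K) = pid_mx g *m row_ebase K.
  by have := eq_row_base K; rewrite /row_base rK.
have -> : pid_mx g = row_mx 1%:M 0 :> 'M[F]_(g, g + m).
  apply/matrixP=> i j; rewrite !mxE; case: splitP => k' ->; rewrite !mxE.
    by rewrite ltn_ord andbT.
  by rewrite ltn_eqF// (leq_trans (ltn_ord i)) ?leq_addr.
by rewrite -{2}[row_ebase K]vsubmxK mul_row_col mul1mx mul0mx addr0.
Qed.

(** A basis of the left eigenspace is completed to a basis of the whole space; [W] acts on the first
    [g] basis vectors as the scalar [z], whence the zero block. *)
Lemma eigenspace_block (F : fieldType) g m (W : 'M[F]_(g + m)) z :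
  \rank (eigenspace W z) = g ->
  exists S C D, [/\ S \in unitmx, (usubmx S :=: eigenspace W z)%MS &
    S *m W = block_mx z%:M 0 C D *m S].
Proof.
move=> rE; have [S uS eS] := eqmx_usubmx_unit rE.
pose T := S *m W *m invmx S.
exists S, (dlsubmx T), (drsubmx T); split=> //.
suff -> : block_mx z%:M 0 (dlsubmx T) (drsubmx T) = T by rewrite mulmxKV.
rewrite -[RHS]submxK; have uT : usubmx T = row_mx z%:M 0.
  rewrite /T -!mul_usub_mx.
  have /eigenspaceP -> : (usubmx S <= eigenspace W z)%MS by rewrite eS.
  rewrite -scalemxAl mul_usub_mx mulmxV// (@scalar_mx_block _ g m 1) /block_mx col_mxKu.
  by rewrite scale_row_mx scaler0 scale_scalar_mx mulr1.
by rewrite /ulsubmx /ursubmx uT row_mxKl row_mxKr.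
Qed.

(** The relation [S W = T S] lifts to the characteristic matrices over the polynomials, where
    [\det S] is a nonzero constant and cancels. *)
Lemma char_poly_sim (F : fieldType) n (W T S : 'M[F]_n) :
  S \in unitmx -> S *m W = T *m S -> char_poly W = char_poly T.
Proof.
move=> uS SW; rewrite /char_poly; pose f := map_mx (@polyC F) : 'M_n -> 'M_n.
have fSW : f S *m char_poly_mx W = char_poly_mx T *m f S.
  by rewrite /char_poly_mx mulmxBr mulmxBl /f -!map_mxM SW scalar_mxC.
have dS : \det (f S) != 0.
  by rewrite det_map_mx polyC_eq0 -unitfE -unitmxE.
by apply: (mulfI dS); rewrite -det_mulmx fSW det_mulmx mulrC.
Qed.

Lemma char_poly_tr (R : comNzRingType) n (M : 'M[R]_n) :
  char_poly M^T = char_poly M.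
Proof.
by rewrite /char_poly -[RHS]det_tr /char_poly_mx linearB/= tr_scalar_mx map_trmx.
Qed.

Lemma char_poly_lblock (R : comNzRingType) g m z (C : 'M[R]_(m, g)) D :
  char_poly (block_mx z%:M 0 C D) = ('X - z%:P) ^+ g * char_poly D.
Proof.
rewrite /char_poly /char_poly_mx map_block_mx scalar_mx_block opp_block_mx.
rewrite add_block_mx map_mx0 subr0 det_lblock; congr (_ * _).
by rewrite map_scalar_mx -raddfB det_scalar.
Qed.

Lemma eigenvalue_unitmx (F : fieldType) n (W : 'M[F]_n) z :
  eigenvalue W z = (W - z%:M \notin unitmx).
Proof.
by rewrite /eigenvalue /eigenspace kermx_eq0 row_free_unit.
Qed.

Lemma mup_char_poly_block (F : fieldType) g m (z : F) (C : 'M[F]_(m, g)) D :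
  mup z (char_poly (block_mx z%:M 0 C D)) = (g + mup z (char_poly D))%N.
Proof.
rewrite char_poly_lblock mupM ?monic_neq0 ?char_poly_monic ?monic_exp ?monicXsubC//.
by rewrite mup_XsubCX eqxx.
Qed.

Lemma mup_char_poly_eq0 (F : fieldType) n (W : 'M[F]_n) z :
  (mup z (char_poly W) == 0%N) = (W - z%:M \in unitmx).
Proof.
rewrite -[RHS]negbK -eigenvalue_unitmx eigenvalue_root_char root_factor_theorem.
by rewrite XsubC_dvd ?lt0n ?negbK// monic_neq0// char_poly_monic.
Qed.

(** * Semi-simplicity as a condition on kernels *)

Lemma subr_scalar_block (R : pzRingType) g m z (C : 'M[R]_(m, g)) (D : 'M[R]_m) :
  block_mx z%:M 0 C D - z%:M = block_mx 0 0 C (D - z%:M).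
Proof.
by rewrite (@scalar_mx_block _ g m z) opp_block_mx add_block_mx !subrr !subr0.
Qed.

(** This says that [W - z] and its square have the same left kernel, that is, that no Jordan block
    for [z] is larger than 1. It holds trivially when [z] is not an eigenvalue. *)
Definition ascent_le1 (F : fieldType) n (W : 'M[F]_n) z :=
  forall u : 'rV_n, u *m (W - z%:M) *m (W - z%:M) = 0 -> u *m (W - z%:M) = 0.

Lemma ascent_le1_sim (F : fieldType) n (W T S : 'M[F]_n) z :
  S \in unitmx -> S *m W = T *m S -> ascent_le1 W z -> ascent_le1 T z.
Proof.
move=> uS SW aW u; have S0 (v : 'rV_n) : v *m S = 0 -> v = 0.
  by move=> vS; rewrite -[v](mulmxK uS) vS mul0mx.
have SWz (v : 'rV_n) : v *m S *m (W - z%:M) = v *m (T - z%:M) *m S.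
  by rewrite -!mulmxA mulmxBr mulmxBl SW scalar_mxC.
move=> u0; apply: S0; rewrite -SWz; apply: aW.
by rewrite !SWz u0 mul0mx.
Qed.

Lemma ascent_le1_block (F : fieldType) g m (W : 'M[F]_(g + m)) z :
  \rank (eigenspace W z) = g -> ascent_le1 W z ->
  exists S D, [/\ S \in unitmx, S *m W = block_mx z%:M 0 0 D *m S &
    D - z%:M \in unitmx].
Proof.
move=> rE aW; have [S [C [D [uS eS SW]]]] := eigenspace_block rE.
have uD : D - z%:M \in unitmx.
  rewrite -row_free_unit -kermx_eq0; apply/eqP/row_matrixP=> i; rewrite row0.
  set v := row i _; have vD : v *m (D - z%:M) = 0.
    by rewrite -row_mul mulmx_ker row0.
  have aT := ascent_le1_sim uS SW aW.
  (* The vector [row_mx 0 v] is killed by the square of the block matrix minus [z], hence already by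
     its first power. It thus lies in the eigenspace, which the first [g] coordinates span, so
     [v = 0]. *)
  have: row_mx 0 v *m (block_mx z%:M 0 C D - z%:M) = 0.
    apply: aT; rewrite subr_scalar_block mul_row_block !mul0mx !add0r vD.
    by rewrite mul_row_block !mul0mx !mulmx0 !addr0 row_mx0.
  move=> /eqP; rewrite mulmxBr subr_eq0 mul_mx_scalar => /eqP vT.
  have: (row_mx 0 v *m S <= eigenspace W z)%MS.
    by apply/eigenspaceP; rewrite -mulmxA SW mulmxA vT scalemxAl.
  rewrite -eS => /submxP[y].
  have -> : y *m usubmx S = row_mx y 0 *m S.
    by rewrite -{2}[S]vsubmxK mul_row_col mul0mx addr0.
  by move=> /(can_inj (mulmxK uS))/eq_row_mx[].
(* [X] solves [(D - z) X = C], so the shear [V] removes the coupling block [C]. *)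
pose X := invmx (D - z%:M) *m C.
pose V : 'M[F]_(g + m) := block_mx 1%:M 0 X 1%:M.
exists (V *m S), D; split=> //.
  by rewrite unitmx_mul uS andbT unitmxE det_lblock !det1 mulr1 unitr1.
rewrite -mulmxA SW !mulmxA; congr (_ *m _).
rewrite !mulmx_block !mulmx0 !mul0mx !mulmx1 !mul1mx !addr0 !add0r.
congr block_mx.
have -> : C = (D - z%:M) *m X by rewrite mulmxA mulmxV// mul1mx.
by rewrite mulmxBl mul_mx_scalar mul_scalar_mx addrC subrK.
Qed.

(** In block form relative to the eigenspace, the algebraic multiplicity is [g] plus the
    multiplicity of [z] for [D]. Both sides therefore amount to [D - z] being invertible. *)
Lemma mup_char_polyP (F : fieldType) n (W : 'M[F]_n) z :
  mup z (char_poly W) = \rank (eigenspace W z) <-> ascent_le1 W z.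
Proof.
move Eg: (\rank _) => g; have := rank_leq_row (eigenspace W z).
rewrite Eg => /subnKC; move: (n - g)%N => m En; subst n; split.
  have [S [C [D [uS eS SW]]]] := eigenspace_block Eg.
  rewrite (char_poly_sim uS SW) mup_char_poly_block => /eqP.
  rewrite -{2}[g]addn0 eqn_add2l mup_char_poly_eq0 => uD.
  apply: (@ascent_le1_sim _ _ (block_mx z%:M 0 C D) _ (invmx S)).
  - by rewrite unitmx_inv.
  - by apply: (can_inj (mulmxK uS)); rewrite mulmxKV// -mulmxA -SW mulKmx.
  move=> u; rewrite -[u]hsubmxK subr_scalar_block !mul_row_block !mulmx0 !add0r.
  move/eqP; rewrite row_mx_eq0 => /andP[_ /eqP v0].
  suff -> : rsubmx u = 0 by rewrite !mul0mx row_mx0.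
  by apply: (can_inj (mulmxK uD)); apply: (can_inj (mulmxK uD)); rewrite v0 !mul0mx.
move=> /(ascent_le1_block Eg)[S [D [uS SW uD]]].
rewrite (char_poly_sim uS SW) mup_char_poly_block -{2}[g]addn0.
by congr (_ + _)%N; apply/eqP; rewrite mup_char_poly_eq0.
Qed.

(** * Squared norms of complex row vectors *)

Section ComplexNorm.
Variable R : realType.
Local Notation C := R[i].

(** The squared modulus takes values in [R], not in [R[i]], so that real arithmetic applies to it
    directly. *)
Definition sqnormc (z : C) : R := complex.Re z ^+ 2 + complex.Im z ^+ 2.

Lemma sqnormc_ge0 z : 0 <= sqnormc z.
Proof. by rewrite addr_ge0 ?sqr_ge0. Qed.

Lemma sqnormc_eq0 z : (sqnormc z == 0) = (z == 0).
Proof. by rewrite paddr_eq0 ?sqr_ge0// !sqrf_eq0 eq_complex. Qed.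

Lemma sqnormcM z w : sqnormc (z * w) = sqnormc z * sqnormc w.
Proof. by case: z w => [a b] [c d]; rewrite /sqnormc /=; ring. Qed.

(** Young's inequality: the difference of the two sides is [s^-1 * |s z - w|^2]. *)
Lemma sqnormcD_le (s : R) z w : 0 < s ->
  sqnormc (z + w) <= (1 + s) * sqnormc z + (1 + s^-1) * sqnormc w.
Proof.
move=> s0; rewrite -subr_ge0.
suff -> : (1 + s) * sqnormc z + (1 + s^-1) * sqnormc w - sqnormc (z + w) =
    s^-1 * sqnormc (s%:C%C * z - w).
  by rewrite mulr_ge0 ?invr_ge0 ?sqnormc_ge0// ltW.
by case: z w => [a b] [c d]; rewrite /sqnormc /=; field; exact: lt0r_neq0.
Qed.

Definition sqnorm n (u : 'rV[C]_n) : R := \sum_i sqnormc (u 0 i).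

Lemma sqnorm_ge0 n (u : 'rV_n) : 0 <= sqnorm u.
Proof. by apply: sumr_ge0 => i _; apply: sqnormc_ge0. Qed.

Lemma sqnorm_eq0 n (u : 'rV_n) : (sqnorm u == 0) = (u == 0).
Proof.
rewrite psumr_eq0 => [|i _]; last exact: sqnormc_ge0.
apply/allP/eqP => [u0|-> i _]; last by rewrite mxE /= sqnormc_eq0.
apply/rowP=> i; rewrite mxE; apply/eqP; rewrite -sqnormc_eq0.
exact: u0 (mem_index_enum i).
Qed.

Lemma sqnorm_gt0 n (u : 'rV_n) : (0 < sqnorm u) = (u != 0).
Proof. by rewrite lt_def sqnorm_eq0 sqnorm_ge0 andbT. Qed.

Lemma sqnormZ n z (u : 'rV_n) : sqnorm (z *: u) = sqnormc z * sqnorm u.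
Proof. by rewrite /sqnorm mulr_sumr; apply: eq_bigr => i _; rewrite mxE sqnormcM. Qed.

Lemma sqnormD_le n (s : R) (u v : 'rV_n) : 0 < s ->
  sqnorm (u + v) <= (1 + s) * sqnorm u + (1 + s^-1) * sqnorm v.
Proof.
move=> s0; rewrite /sqnorm !mulr_sumr -big_split /=.
by apply: ler_sum => i _; rewrite mxE sqnormcD_le.
Qed.

Lemma sqnorm_row_mx m n (u : 'rV_m) (v : 'rV_n) :
  sqnorm (row_mx u v) = sqnorm u + sqnorm v.
Proof.
rewrite /sqnorm big_split_ord /=.
by congr (_ + _); apply: eq_bigr => i _; rewrite ?row_mxEl ?row_mxEr.
Qed.

(** Induction on the number of rows of [M]: the first row contributes a scalar multiple of itself,
    and adding the two parts costs a factor 2. *)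
Lemma sqnorm_mul_bounded m n (M : 'M[C]_(m, n)) :
  exists2 K, 0 <= K & forall u : 'rV_m, sqnorm (u *m M) <= K * sqnorm u.
Proof.
elim: m M => [|m IHm] M.
  by exists 0 => // u; rewrite (thinmx0 u) mul0mx mul0r /sqnorm big1// => i _;
    apply/eqP; rewrite mxE sqnormc_eq0.
rewrite -[M](@vsubmxK _ 1 m) in IHm *; set M1 := usubmx _; set M2 := dsubmx _.
have [K K0 bK] := IHm M2.
exists (2 * sqnorm M1 + 2 * K).
  by rewrite addr_ge0// mulr_ge0// sqnorm_ge0.
move=> u; rewrite -[u](@hsubmxK _ 1 1 m) (@mul_row_col _ 1 1 m).
rewrite (@sqnorm_row_mx 1 m); set a := lsubmx _; set v := rsubmx _.
have -> : a *m M1 = a 0 0 *: M1 by rewrite -mul_scalar_mx -mx11_scalar.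
have sa : sqnorm a = sqnormc (a 0 0) by rewrite /sqnorm big_ord1.
apply: le_trans (sqnormD_le _ _ (ltr01 : 0 < 1 :> R)) _.
rewrite sqnormZ sa invr1.
have := bK v; have := sqnormc_ge0 (a 0 0); have := sqnorm_ge0 v.
by have := sqnorm_ge0 M1; nra.
Qed.

(** * Contractivity after a change of basis *)

Lemma eigenvalue_exists n (W : 'M[C]_n) :
  (0 < n)%N -> exists z, eigenvalue W z.
Proof.
move=> n0; have : size (char_poly W) != 1%N by rewrite size_char_poly; case: n n0 W.
by move=> /closed_rootP[z rz]; exists z; rewrite eigenvalue_root_char.
Qed.

(** This is the induction step for strict contractions: [p] is the component along the eigenspace,
    [v] the complementary one, and a small weight [d] on [p] controls the coupling term [v *m B]. *)
Lemma contraction_block g m (z : C) (B : 'M[C]_(m, g)) (D Q : 'M[C]_m) (q : R) :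
  sqnormc z < 1 -> Q \in unitmx -> 0 <= q < 1 ->
  (forall v : 'rV_m, sqnorm (v *m D *m Q) <= q * sqnorm (v *m Q)) ->
  exists d q', [/\ 0 < d, 0 <= q' < 1 & forall (p : 'rV_g) (v : 'rV_m),
    d ^+ 2 * sqnorm (z *: p + v *m B) + sqnorm (v *m D *m Q) <=
    q' * (d ^+ 2 * sqnorm p + sqnorm (v *m Q))].
Proof.
move=> z1 uQ /andP[q0 q1] DQ.
have [K K0 bK] := sqnorm_mul_bounded (invmx Q *m B).
have bB (v : 'rV_m) : sqnorm (v *m B) <= K * sqnorm (v *m Q).
  by have := bK (v *m Q); rewrite mulmxA mulmxK.
have z0 := sqnormc_ge0 z.
(* This choice keeps [(1 + s) * |z|^2] below 1. *)
pose s := (1 - sqnormc z) / 2.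
have s0 : 0 < s by rewrite /s; lra.
pose c := (1 + s^-1) * K.
have c0 : 0 <= c by rewrite mulr_ge0// addr_ge0// invr_ge0 ltW.
(* [d2] is such that half of the gap [1 - q] absorbs the coupling term [c]. *)
pose d2 := (1 - q) / (2 * (c + 1)).
have d2c : d2 * c <= (1 - q) / 2.
  have -> : d2 * c = (1 - q) / 2 * (c / (c + 1)) by rewrite /d2; field; lra.
  by rewrite ger_pMr ?ler_pdivrMr ?mul1r; lra.
have d20 : 0 < d2 by rewrite divr_gt0; lra.
(* The first rate is the one for [p]; the second is what remains for [v] after half of its gap has
   been spent on the coupling. *)
pose q' := Num.max ((1 + s) * sqnormc z) ((1 + q) / 2).
exists (Num.sqrt d2), q'; split.
- by rewrite sqrtr_gt0.
- rewrite le_max gt_max; apply/andP; split; first by apply/orP; right; lra.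
  by apply/andP; split; rewrite /s; nra.
move=> p v; rewrite sqr_sqrtr; last exact: ltW.
have := sqnormD_le (z *: p) (v *m B) s0; rewrite sqnormZ => h.
have h1 : (1 + s^-1) * sqnorm (v *m B) <= c * sqnorm (v *m Q).
  by rewrite -mulrA ler_wpM2l// addr_ge0// invr_ge0 ltW.
have p0 := sqnorm_ge0 p; have vQ0 := sqnorm_ge0 (v *m Q).
have q1' : (1 + s) * sqnormc z <= q' by rewrite le_max lexx.
have q2' : (1 + q) / 2 <= q' by rewrite le_max lexx orbT.
have e1 := ler_wpM2r p0 q1'.
have e2 := ler_wpM2r vQ0 q2'.
have e3 := ler_wpM2r vQ0 d2c.
have e4 := DQ v.
have e5 : sqnorm (z *: p + v *m B) <= q' * sqnorm p + c * sqnorm (v *m Q) by lra.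
have := ler_wpM2l (ltW d20) e5; lra.
Qed.

(** Strong induction on the dimension, splitting off one eigenspace at a time. The uniform factor
    [q < 1] is part of the conclusion because the next step consumes some of the gap [1 - q]. *)
Lemma sim_strict_contraction n (W : 'M[C]_n) :
  (forall z, eigenvalue W z -> sqnormc z < 1) ->
  exists Q q, [/\ Q \in unitmx, 0 <= q < 1 &
    forall u : 'rV_n, sqnorm (u *m W *m Q) <= q * sqnorm (u *m Q)].
Proof.
elim/ltn_ind: n W => n IHn W W1.
case: (posnP n) => [n0|/(eigenvalue_exists W)[z ez]].
  subst n; exists 1%:M, 0; split; rewrite ?unitmx1 ?lexx ?ltr01// => u.
  by rewrite (thinmx0 u) !mul0mx mul0r le_eqVlt sqnorm_eq0 eqxx.
have z1 := W1 z ez; move: ez; rewrite /eigenvalue -mxrank_eq0.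
move Eg: (\rank _) => g; have := rank_leq_row (eigenspace W z).
rewrite Eg => /subnKC; move: (n - g)%N => m En g0; subst n.
have [S [B [D [uS _ SW]]]] := eigenspace_block Eg.
have [] := IHn m _ D.
- by rewrite -[X in (X < _)%N]add0n ltn_add2r lt0n.
- move=> a; rewrite eigenvalue_root_char => ra; apply: W1.
  rewrite eigenvalue_root_char (char_poly_sim uS SW) char_poly_lblock.
  by rewrite rootM ra orbT.
move=> Q [q [uQ q01 DQ]].
have [d [q' [d0 q'01 H]]] := contraction_block B z1 uQ q01 DQ.
pose T : 'M[C]_(g + m) := block_mx (d%:C%C)%:M 0 0 Q.
exists (invmx S *m T), q'; split=> //.
  rewrite unitmx_mul unitmx_inv uS unitmxE det_ublock det_scalar unitrM -unitmxE uQ.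
  by rewrite andbT unitrX// unitfE eq_complex /= gt_eqF.
move=> u; rewrite -[u](mulmxKV uS); set y := u *m invmx S.
rewrite -[y *m S *m W]mulmxA SW !mulmxA mulmxK// (mulmxK uS) -[y]hsubmxK.
set p := lsubmx y; set v := rsubmx y.
rewrite /T !mul_row_block !mulmx0 !add0r !addr0.
rewrite !sqnorm_row_mx !mul_mx_scalar !sqnormZ.
have -> : sqnormc d%:C%C = d ^+ 2 by rewrite /sqnormc /= expr0n addr0.
exact: H.
Qed.

(** Eigenvalues on the unit circle are split off one by one as direct summands; once none is left,
    the strict case applies. *)
Lemma sim_contraction n (W : 'M[C]_n) :
  (forall z, eigenvalue W z -> sqnormc z <= 1) ->
  (forall z, sqnormc z = 1 -> ascent_le1 W z) ->
  exists2 Q, Q \in unitmx &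
    forall u : 'rV_n, sqnorm (u *m W *m Q) <= sqnorm (u *m Q).
Proof.
elim/ltn_ind: n W => n IHn W W1 aW.
have [[z ez z1]|W1'] :=
  pselect (exists2 z, eigenvalue W z & sqnormc z = 1); last first.
  have [z ez|Q [q [uQ /andP[_ q1] H]]] := @sim_strict_contraction _ W.
    by rewrite lt_neqAle W1// andbT; apply/eqP=> z1; apply: W1'; exists z.
  exists Q => // u; apply: le_trans (H u) _.
  by rewrite ler_piMl ?sqnorm_ge0// ltW.
move: ez; rewrite /eigenvalue -mxrank_eq0.
move Eg: (\rank _) => g; have := rank_leq_row (eigenspace W z).
rewrite Eg => /subnKC; move: (n - g)%N => m En g0; subst n.
have [S [D [uS SW uD]]] := ascent_le1_block Eg (aW z z1).
have [] := IHn m _ D.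
- by rewrite -[X in (X < _)%N]add0n ltn_add2r lt0n.
- move=> a; rewrite eigenvalue_root_char => ra; apply: W1.
  rewrite eigenvalue_root_char (char_poly_sim uS SW) char_poly_lblock.
  by rewrite rootM ra orbT.
(* The kernel condition passes from [W] to [D]: on [row_mx 0 v] the block diagonal matrix acts
   through [D]. *)
- move=> a a1 v v0; have := ascent_le1_sim uS SW (aW a a1) (u := row_mx 0 v).
  rewrite (@scalar_mx_block _ g m a) opp_block_mx add_block_mx.
  rewrite !subr0 !mul_row_block !mul0mx !mulmx0 !add0r mul0mx add0r v0.
  by rewrite row_mx0 => /(_ erefl)/eqP; rewrite row_mx_eq0 => /andP[_ /eqP].
(* The blocks are uncoupled and the first one is a scalar of modulus 1, so weight 1 suffices
   there. *)
move=> Q uQ H; pose T : 'M[C]_(g + m) := block_mx 1%:M 0 0 Q.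
exists (invmx S *m T).
  by rewrite unitmx_mul unitmx_inv uS unitmxE det_ublock det1 mul1r -unitmxE.
move=> u; rewrite -[u](mulmxKV uS); set y := u *m invmx S.
rewrite -[y *m S *m W]mulmxA SW !mulmxA mulmxK// (mulmxK uS) -[y]hsubmxK.
set p := lsubmx y; set v := rsubmx y.
rewrite /T !mul_row_block !mulmx0 !add0r !addr0.
rewrite !sqnorm_row_mx !mulmx1 mul_mx_scalar sqnormZ z1 mul1r.
by rewrite lerD2l.
Qed.

End ComplexNorm.

(** * Real inner products: their matrices and their extension to complex vectors *)

Section RealInnerProduct.
Variables (R : realType) (n : nat).
Implicit Types (P B : 'M[R]_n) (x y z : 'cV[R]_n).

(** The proof of positive definiteness is an argument so that the inner product structure can be
    attached to this constant. *)
Definition posdefmx_dot P (_ : posdefmx P) x y : R := (x^T *m P *m y) 0 0.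

Lemma posdefmx_dot_bilinear P (hP : posdefmx P) :
  bilinear_for (GRing.Scale.Law.clone _ _ *%R _)
    (GRing.Scale.Law.clone _ _ (idfun \; *%R) _) (posdefmx_dot hP).
Proof.
split=> [y|x] a u v /=; rewrite /posdefmx_dot.
  by rewrite linearP/= !mulmxDl -!scalemxAl !mxE.
by rewrite mulmxDr -scalemxAr !mxE.
Qed.

HB.instance Definition _ P (hP : posdefmx P) :=
  bilinear_isBilinear.Build R 'cV[R]_n 'cV[R]_n R _ _ (posdefmx_dot hP)
    (posdefmx_dot_bilinear hP).

Lemma posdefmx_dot_sym P (hP : posdefmx P) x y :
  posdefmx_dot hP x y = (-1) ^+ false * idfun (posdefmx_dot hP y x).
Proof.
rewrite expr0 mul1r /= /posdefmx_dot.
have /is_hermitianmxP := hP.1; rewrite expr0 scale1r map_mx_id// => PT.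
transitivity ((x^T *m P *m y)^T 0 0); first by rewrite [RHS]mxE.
by rewrite !trmx_mul trmxK -PT mulmxA.
Qed.

HB.instance Definition _ P (hP : posdefmx P) :=
  isHermitianSesquilinear.Build R 'cV[R]_n false idfun (posdefmx_dot hP)
    (posdefmx_dot_sym hP).

HB.instance Definition _ P (hP : posdefmx P) :=
  isDotProduct.Build R 'cV[R]_n (posdefmx_dot hP) hP.2.

Lemma dot_of_posdefmx P : posdefmx P ->
  exists f : {dot 'cV[R]_n for idfun}, forall x y, f x y = (x^T *m P *m y) 0 0.
Proof. by move=> hP; exists (posdefmx_dot hP : {dot 'cV[R]_n for idfun}). Qed.

Variable f : {dot 'cV[R]_n for idfun}.

Lemma dotC x y : f x y = f y x.
Proof. by rewrite (hermC f) expr0 mul1r. Qed.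

Lemma dotZl a x y : f (a *: x) y = a * f x y.
Proof. exact: linearZl_LR. Qed.

Lemma dotZr a x y : f x (a *: y) = a * f x y.
Proof. exact: linearZr_LR. Qed.

Lemma dot_gt0 x : x != 0 -> 0 < f x x.
Proof. exact: neq0_dnorm_gt0. Qed.

Lemma dot_ge0 x : 0 <= f x x.
Proof.
by have [->|/dot_gt0/ltW//] := eqVneq x 0; rewrite linear0r.
Qed.

Lemma dotDl x y z : f (x + y) z = f x z + f y z.
Proof. exact: linearDl. Qed.

Lemma dotNl x y : f (- x) y = - f x y.
Proof. exact: linearNl. Qed.

Lemma dotDr x y z : f x (y + z) = f x y + f x z.
Proof. exact: linearDr. Qed.

Lemma dotNr x y : f x (- y) = - f x y.
Proof. exact: linearNr. Qed.

Definition dotE := (dotDl, dotDr, dotNl, dotNr, dotZl, dotZr).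

Lemma sqr_hilbert_norm x : hilbert_norm f x ^+ 2 = f x x.
Proof. by rewrite sqr_sqrtr// dot_ge0. Qed.

Lemma posdefmx_of_dot :
  exists2 P, posdefmx P & forall x y, f x y = (x^T *m P *m y) 0 0.
Proof.
(* The Gram matrix of the standard basis. *)
pose P : 'M[R]_n := \matrix_(i, j) f (delta_mx i 0) (delta_mx j 0).
have fP x y : f x y = (x^T *m P *m y) 0 0.
  rewrite [x in LHS]matrix_sum_delta [y in LHS]matrix_sum_delta.
  rewrite -mulmxA mxE linear_sumlz /=; apply: eq_bigr => i _.
  rewrite big_ord1 dotZl !mxE linear_sumr /=; congr (_ * _); apply: eq_bigr => j _.
  by rewrite big_ord1 dotZr mxE mulrC.
exists P => //; split; last by move=> x /dot_gt0; rewrite fP.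
apply/is_hermitianmxP; rewrite expr0 scale1r map_mx_id//.
by apply/matrixP=> i j; rewrite !mxE dotC.
Qed.

(* A row [u] stands for the column [u^T], on which a real matrix [B] acts by
   [u |-> u *m (complexmx B)^T]. *)
Definition re_col (u : 'rV[R[i]]_n) : 'cV[R]_n := (map_mx (@complex.Re R) u)^T.
Definition im_col (u : 'rV[R[i]]_n) : 'cV[R]_n := (map_mx (@complex.Im R) u)^T.

Lemma re_colD u v : re_col (u + v) = re_col u + re_col v.
Proof. by apply/matrixP=> i j; rewrite !mxE; case: (u _ _) (v _ _) => [? ?] []. Qed.

Lemma im_colD u v : im_col (u + v) = im_col u + im_col v.
Proof. by apply/matrixP=> i j; rewrite !mxE; case: (u _ _) (v _ _) => [? ?] []. Qed.

Lemma re_colZ (z : R[i]) u :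
  re_col (z *: u) = complex.Re z *: re_col u - complex.Im z *: im_col u.
Proof. by apply/matrixP=> i j; rewrite !mxE; case: (u _ _) z => [? ?] []. Qed.

Lemma im_colZ (z : R[i]) u :
  im_col (z *: u) = complex.Re z *: im_col u + complex.Im z *: re_col u.
Proof. by apply/matrixP=> i j; rewrite !mxE; case: (u _ _) z => [? ?] []. Qed.

Lemma re_col_mul u B : re_col (u *m (complexmx B)^T) = B *m re_col u.
Proof.
apply/matrixP=> i j; rewrite !mxE.
rewrite (big_morph (@complex.Re R) (id1 := 0) (op1 := +%R)) => [|[? ?] []|]//.
by apply: eq_bigr => k _; rewrite !mxE; case: (u _ _) => a b /=; ring.
Qed.

Lemma im_col_mul u B : im_col (u *m (complexmx B)^T) = B *m im_col u.
Proof.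
apply/matrixP=> i j; rewrite !mxE.
rewrite (big_morph (@complex.Im R) (id1 := 0) (op1 := +%R)) => [|[? ?] []|]//.
by apply: eq_bigr => k _; rewrite !mxE; case: (u _ _) => a b /=; ring.
Qed.

(** The real part of the Hermitian extension of [f] to complex vectors; it is symmetric, real
    bilinear, and has the same diagonal as that extension. *)
Definition complex_dot u v : R :=
  f (re_col u) (re_col v) + f (im_col u) (im_col v).
Local Notation complex_sqnorm u := (complex_dot u u).

Lemma complex_sqnorm_gt0 u : u != 0 -> 0 < complex_sqnorm u.
Proof.
move=> u0; rewrite /complex_dot.
have [re0|re0] := eqVneq (re_col u) 0; last first.
  by rewrite ltr_pwDl ?dot_ge0 ?dot_gt0.
have [im0|im0] := eqVneq (im_col u) 0; last first.
  by rewrite ltr_pwDr ?dot_ge0 ?dot_gt0.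
case/eqP: u0; apply/rowP=> i; apply/eqP; rewrite mxE eq_complex.
move/matrixP/(_ i 0): re0; move/matrixP/(_ i 0): im0; rewrite !mxE => -> ->.
by rewrite eqxx.
Qed.

Lemma complex_sqnormZ (z : R[i]) u :
  complex_sqnorm (z *: u) = sqnormc z * complex_sqnorm u.
Proof.
rewrite /complex_dot re_colZ im_colZ !dotE (dotC (im_col u) (re_col u)).
by rewrite /sqnormc; ring.
Qed.

Lemma complex_dotDr u v w :
  complex_dot u (v + w) = complex_dot u v + complex_dot u w.
Proof. by rewrite /complex_dot re_colD im_colD !dotE addrACA. Qed.

Lemma complex_dotZr (t : R) u v :
  complex_dot u (t%:C%C *: v) = t * complex_dot u v.
Proof.
by rewrite /complex_dot re_colZ im_colZ /= !scale0r subr0 addr0 !dotE mulrDr.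
Qed.

Lemma complex_dotC u v : complex_dot u v = complex_dot v u.
Proof. by rewrite /complex_dot dotC [X in _ + X]dotC. Qed.

Section Nonexpansive.
Variable B : 'M[R]_n.
Hypothesis fB : forall x, f (B *m x) (B *m x) <= f x x.
Local Notation W := (complexmx B)^T.

Lemma complex_sqnorm_mul u : complex_sqnorm (u *m W) <= complex_sqnorm u.
Proof. by rewrite /complex_dot re_col_mul im_col_mul lerD. Qed.

Lemma nonexpansive_eigenvalue (z : R[i]) : eigenvalue W z -> sqnormc z <= 1.
Proof.
move=> /eigenvalueP[u uW /complex_sqnorm_gt0 u0].
by have := complex_sqnorm_mul u; rewrite uW complex_sqnormZ ger_pMl.
Qed.

(* If [v = u (W - z)] is killed by [W - z] then, for [s = z^-1 v], [W] maps
   [y = u + t s] to [z (y + s)], so that [|y + s| <= |y|] for all real [t]; this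
   fails if [t] is chosen such that [y] is orthogonal to [s != 0]. *)
Lemma nonexpansive_ascent (z : R[i]) : sqnormc z = 1 -> ascent_le1 W z.
Proof.
move=> z1 u; set v := u *m (W - z%:M) => v0.
have uW : u *m W = z *: u + v.
  by rewrite /v mulmxBr mul_mx_scalar addrC subrK.
have vW : v *m W = z *: v.
  by move/eqP: v0; rewrite mulmxBr mul_mx_scalar subr_eq0 => /eqP.
have z0 : z != 0 by rewrite -sqnormc_eq0 z1 oner_eq0.
apply/eqP/negPn/negP=> vN0; pose s := z^-1 *: v.
have s0 : 0 < complex_sqnorm s.
  by rewrite complex_sqnorm_gt0// scaler_eq0 invr_eq0 negb_or z0.
pose t := - complex_dot s u / complex_sqnorm s; pose y := u + t%:C%C *: s.
have ys : complex_dot s y = 0.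
  rewrite complex_dotDr complex_dotZr /t -mulrA mulVf ?gt_eqF// mulr1.
  by rewrite addrN.
have yW : y *m W = z *: (y + s).
  rewrite /y /s mulmxDl -!scalemxAl uW vW !scalerDr -addrA [v + _]addrC addrA.
  by rewrite !scalerA divfK// mulrAC mulfV// mul1r scale1r.
clearbody y s; have := complex_sqnorm_mul y; rewrite yW complex_sqnormZ z1 mul1r.
rewrite complex_dotDr !(complex_dotC (y + s)) !complex_dotDr ys add0r.
by rewrite (complex_dotC y s) ys addr0 gerDl leNgt s0.
Qed.

End Nonexpansive.

End RealInnerProduct.

(** [P] is the real part of [Q Q^*]: for real [x], the real and imaginary parts of [x^T Q] are
    [x^T Q1] and [x^T Q2]. Definiteness comes from the invertibility of [Q]. *)
Lemma posdefmx_of_complex_unit (R : realType) n (Q : 'M[R[i]]_n) :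
  Q \in unitmx -> exists2 P : 'M[R]_n, posdefmx P &
    forall x, (x^T *m P *m x) 0 0 = sqnorm (map_mx (real_complex R) x^T *m Q).
Proof.
move=> uQ.
pose Q1 : 'M[R]_n := map_mx (@complex.Re R) Q.
pose Q2 : 'M[R]_n := map_mx (@complex.Im R) Q.
pose P := Q1 *m Q1^T + Q2 *m Q2^T.
have PE x : (x^T *m P *m x) 0 0 = sqnorm (map_mx (real_complex R) x^T *m Q).
  have dotT (y : 'rV[R]_n) : (y *m y^T) 0 0 = \sum_i y 0 i ^+ 2.
    by rewrite mxE; apply: eq_bigr => i _; rewrite mxE expr2.
  have -> : x^T *m P *m x = (x^T *m Q1) *m (x^T *m Q1)^T + (x^T *m Q2) *m (x^T *m Q2)^T.
    by rewrite !trmx_mul trmxK mulmxDr mulmxDl !mulmxA.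
  rewrite mxE !dotT -big_split; apply: eq_bigr => j _; rewrite /sqnormc /=.
  congr (_ ^+ 2 + _ ^+ 2); rewrite !mxE.
    rewrite (big_morph (@complex.Re R) (id1 := 0) (op1 := +%R)) => [|[? ?] []|]//.
    by apply: eq_bigr => k _; rewrite !mxE; case: (Q _ _) => a b /=; ring.
  rewrite (big_morph (@complex.Im R) (id1 := 0) (op1 := +%R)) => [|[? ?] []|]//.
  by apply: eq_bigr => k _; rewrite !mxE; case: (Q _ _) => a b /=; ring.
exists P => //; split.
  apply/is_hermitianmxP; rewrite expr0 scale1r map_mx_id//.
  by rewrite /P linearD /= !trmx_mul !trmxK.
move=> x x0; rewrite PE sqnorm_gt0.
apply: contra x0 => /eqP xQ.
have /eqP : map_mx (real_complex R) x^T = 0.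
  by rewrite -[LHS](mulmxK uQ) xQ mul0mx.
by rewrite map_mx_eq0 trmx_eq0.
Qed.

(** * Affine changes of a matrix and of its eigenvalues *)

Lemma subr_scalar_affine (F : fieldType) n (W : 'M[F]_n) a b z :
  a%:M + b *: W - (a + b * z)%:M = b *: (W - z%:M).
Proof.
by rewrite raddfD /= opprD addrACA subrr add0r scalerBr scale_scalar_mx.
Qed.

Lemma eigenvalue_affine (F : fieldType) n (W : 'M[F]_n) a b z : b != 0 ->
  eigenvalue (a%:M + b *: W) (a + b * z) = eigenvalue W z.
Proof.
move=> b0; rewrite !eigenvalue_unitmx subr_scalar_affine.
by rewrite !unitmxE detZ unitrM unitrX ?unitfE.
Qed.

Lemma ascent_le1_affine (F : fieldType) n (W : 'M[F]_n) a b z : b != 0 ->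
  ascent_le1 (a%:M + b *: W) (a + b * z) <-> ascent_le1 W z.
Proof.
move=> b0; rewrite /ascent_le1 subr_scalar_affine.
have eq0 (x : 'rV[F]_n) : b *: x = 0 <-> x = 0.
  by split=> /eqP; [|move=> ?; apply/eqP]; rewrite scaler_eq0 (negPf b0) => // /eqP.
by split=> aW u; have := aW u; rewrite -!scalemxAr -?scalemxAl !eq0.
Qed.

(** * The norm conditions and the matrix inequality as one quadratic inequality *)

Section LinearMaps.
Variables (R : realType) (n : nat) (A : 'M[R]_n) (kappa eta : R).
Variable f : {dot 'cV[R]_n for idfun}.
Hypotheses (hkappa : 0 < kappa < 1) (heta : 0 < eta < 1).

Definition pseudocontractive_form :=
  forall x, (1 - kappa) * f (A *m x) (A *m x) <=
    (1 + kappa) * f x x - 2 * kappa * f x (A *m x).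

(** By linearity the two-point condition depends only on [x - y], so the case [y = 0] carries all of
    it. *)
Lemma strictly_pseudocontractiveP :
  strictly_pseudocontractive kappa (hilbert_norm f) (fun x => A *m x) <->
  pseudocontractive_form.
Proof.
have E x : f (x - A *m x) (x - A *m x) =
    f x x - 2 * f x (A *m x) + f (A *m x) (A *m x).
  by rewrite !dotE (dotC f (A *m x) x); ring.
split=> [h x|h x y].
  have := h x 0; rewrite !sqr_hilbert_norm mulmx0 !subr0 E; lra.
rewrite !sqr_hilbert_norm -mulmxBr.
rewrite [_ - (y - _)](_ : _ = x - y - A *m (x - y)); last first.
  by rewrite mulmxBr !opprD addrACA.
by rewrite E; have := h (x - y); lra.
Qed.

Lemma nonexpansiveP (B : 'M[R]_n) :
  nonexpansive (hilbert_norm f) (fun x => B *m x) <->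
  forall x, f (B *m x) (B *m x) <= f x x.
Proof.
split=> [h x|h x y]; last by rewrite /hilbert_norm -mulmxBr ler_sqrt ?dot_ge0.
by have := h x 0; rewrite /hilbert_norm mulmx0 !subr0 ler_sqrt ?dot_ge0.
Qed.

Lemma nonexpansive_affineP :
  (forall x, f ((kappa%:M + (1 - kappa) *: A) *m x)
               ((kappa%:M + (1 - kappa) *: A) *m x) <= f x x) <->
  pseudocontractive_form.
Proof.
have [k0 k1] := andP hkappa.
have E x : f x x - f ((kappa%:M + (1 - kappa) *: A) *m x)
               ((kappa%:M + (1 - kappa) *: A) *m x) =
    (1 - kappa) * ((1 + kappa) * f x x - 2 * kappa * f x (A *m x) -
      (1 - kappa) * f (A *m x) (A *m x)).
  rewrite mulmxDl mul_scalar_mx -scalemxAl !dotE (dotC f (A *m x) x).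
  by ring.
have k1' : 0 < 1 - kappa by rewrite subr_gt0.
split=> h x; last by rewrite -subr_ge0 E pmulr_rge0// subr_ge0.
by have := h x; rewrite -subr_ge0 E pmulr_rge0// subr_ge0.
Qed.

(** Here [x - T x = alpha (x - A x)] and [1 + (1 - eta) / eta = 1 / eta]. As
    [alpha / eta = 1 - kappa], the gap in the averagedness inequality is [alpha] times the gap in
    the quadratic one. *)
Lemma averagedP (alpha := eta * (1 - kappa)) :
  averaged eta (hilbert_norm f)
    (fun x => ((1 - alpha)%:M + alpha *: A) *m x) <->
  pseudocontractive_form.
Proof.
have [k0 k1] := andP hkappa; have [e0 e1] := andP heta.
set T := _ + _.
have E x : f x x - (1 - eta) / eta * f (x - T *m x) (x - T *m x) -
    f (T *m x) (T *m x) = alpha *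
    ((1 + kappa) * f x x - 2 * kappa * f x (A *m x) -
      (1 - kappa) * f (A *m x) (A *m x)).
  rewrite /T mulmxDl mul_scalar_mx -scalemxAl !dotE (dotC f (A *m x) x) /alpha.
  by field; exact: lt0r_neq0.
have a0 : 0 < alpha by rewrite mulr_gt0// subr_gt0.
split=> [h x|h x y].
  have := h x 0; rewrite !sqr_hilbert_norm mulmx0 !subr0 -subr_ge0 E.
  by rewrite pmulr_rge0// subr_ge0.
rewrite !sqr_hilbert_norm -mulmxBr.
rewrite [_ - (y - _)](_ : _ = x - y - T *m (x - y)); last first.
  by rewrite mulmxBr !opprD addrACA.
by rewrite -subr_ge0 E pmulr_rge0// subr_ge0.
Qed.

End LinearMaps.

(** The quadratic form of [A^T P + P A] at [x] is [2 f x (A x)], so evaluating the matrix inequality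
    at [x] gives the quadratic one. The symmetry of the difference [M] follows from that of [P]. *)
Lemma loewner_pseudocontractiveP (R : realType) n (A P : 'M[R]_n) kappa
    (f : {dot 'cV[R]_n for idfun}) :
  posdefmx P -> (forall x y, f x y = (x^T *m P *m y) 0 0) ->
  loewner_le ((1 - kappa) *: (A^T *m P *m A))
    ((1 + kappa) *: P - kappa *: (A^T *m P + P *m A)) <->
  pseudocontractive_form A kappa f.
Proof.
move=> [/is_hermitianmxP]; rewrite expr0 scale1r map_mx_id// => PT _ fP.
rewrite /loewner_le; set M := _ - _.
have E x : (x^T *m M *m x) 0 0 = (1 + kappa) * f x x -
    2 * kappa * f x (A *m x) - (1 - kappa) * f (A *m x) (A *m x).
  have -> : 2 * kappa * f x (A *m x) = kappa * (f (A *m x) x + f x (A *m x)).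
    by rewrite (dotC f (A *m x) x); ring.
  rewrite !fP trmx_mul /M.
  rewrite !(mulmxBr, mulmxBl, mulmxDr, mulmxDl) -!scalemxAr mulNmx -!scalemxAl.
  by rewrite !(mulmxDr, mulmxDl) !mulmxA !mxE; ring.
split=> [[_ h] x|h]; first by have := h x; rewrite E subr_ge0.
split=> [|x]; last by rewrite E subr_ge0.
apply/is_hermitianmxP; rewrite expr0 scale1r map_mx_id//.
have : (A^T *m P *m A)^T = A^T *m P *m A by rewrite !trmx_mul trmxK -PT mulmxA.
have : (A^T *m P + P *m A)^T = A^T *m P + P *m A.
  by rewrite raddfD /= !trmx_mul trmxK -PT addrC.
rewrite /M; move: (A^T *m P + P *m A) (A^T *m P *m A) => X Y XT YT; apply/matrixP=> i j.
by rewrite -[X in LHS]XT -[Y in LHS]YT [P in LHS]PT !mxE.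
Qed.

(** * The affine map from the eigenvalue disk to the unit disk *)

Section Disk.
Variables (R : realType) (kappa : R).
Hypothesis hkappa : 0 < kappa < 1.
Let rho := 1 / (1 - kappa).
Let mu (z : R[i]) := kappa%:C%C + (1 - kappa)%:C%C * z.

(** Since [1 - rho = - kappa * rho], subtracting the centre from [z] gives exactly [rho * mu z]. *)
Lemma disk_normE z : `|z - (1 - rho)%:C%C| = (rho * Num.sqrt (sqnormc (mu z)))%:C%C.
Proof.
have [k0 k1] := andP hkappa.
have -> : z - (1 - rho)%:C%C = rho%:C%C * mu z.
  case: z => a b; apply/eqP; rewrite eq_complex /rho /=.
  by apply/andP; split; apply/eqP; field; lra.
rewrite normc_def -/(sqnormc _) sqnormcM sqrtrM ?sqnormc_ge0//.
by rewrite /sqnormc /= expr0n addr0 sqrtr_sqr ger0_norm// divr_ge0//; lra.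
Qed.

Lemma in_diskE z : in_disk rho z <-> sqnormc (mu z) <= 1.
Proof.
have [k0 k1] := andP hkappa.
have r0 : 0 < rho by rewrite divr_gt0//; lra.
rewrite /in_disk disk_normE lecR ger_pMr//.
by rewrite -{1}(sqrtr1 R) ler_sqrt.
Qed.

Lemma on_disk_boundaryE z : on_disk_boundary rho z <-> sqnormc (mu z) = 1.
Proof.
have [k0 k1] := andP hkappa.
have r0 : 0 < rho by rewrite divr_gt0//; lra.
rewrite /on_disk_boundary disk_normE; split=> [/complexI|->]; last first.
  by rewrite sqrtr1 mulr1.
rewrite -[RHS]mulr1 => /(mulfI (lt0r_neq0 r0)) h.
by rewrite -(sqr_sqrtr (sqnormc_ge0 _)) h expr1n.
Qed.

End Disk.

Lemma complexmx_affine (R : realType) n (A : 'M[R]_n) (a b : R) :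
  (complexmx (a%:M + b *: A))^T = (a%:C%C)%:M + b%:C%C *: (complexmx A)^T.
Proof.
by rewrite /complexmx map_mxD map_scalar_mx map_mxZ linearD linearZ /= tr_scalar_mx.
Qed.

Lemma semisimpleP (F : fieldType) n (M : 'M[F]_n) z :
  semisimple M z <-> ascent_le1 M^T z.
Proof.
rewrite /semisimple /alg_multiplicity /geom_multiplicity -char_poly_tr.
exact: mup_char_polyP.
Qed.

Theorem lemma5 (R : realType) (n : nat) (A : 'M[R]_n) (kappa eta : R)
  (hkappa : 0 < kappa < 1) (heta : 0 < eta < 1) :
  [<->
    (* (i) *)
    exists f : {dot 'cV[R]_n for idfun},
      strictly_pseudocontractive kappa (hilbert_norm f) (fun x => A *m x);
    (* (ii) *)
    exists P : 'M[R]_n, posdefmx P /\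
      loewner_le ((1 - kappa) *: (A^T *m P *m A))
        ((1 + kappa) *: P - kappa *: (A^T *m P + P *m A));
    (* (iii) *)
    let As := kappa%:M + (1 - kappa) *: A in
    exists f : {dot 'cV[R]_n for idfun},
      nonexpansive (hilbert_norm f) (fun x => As *m x);
    (* (iv) *)
    let rho := 1 / (1 - kappa) in
    forall z : R[i], col_eigenvalue (complexmx A) z ->
      in_disk rho z /\
      (on_disk_boundary rho z -> semisimple (complexmx A) z);
    (* (v) *)
    let alpha := eta * (1 - kappa) in
    let Aalpha := (1 - alpha)%:M + alpha *: A in
    0 < alpha < 1 /\
    exists f : {dot 'cV[R]_n for idfun},
      averaged eta (hilbert_norm f) (fun x => Aalpha *m x)
  ].
Proof.
have [k0 k1] := andP hkappa; have [e0 e1] := andP heta.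
have kC : (1 - kappa)%:C%C != 0 :> R[i] by rewrite eq_complex /= negb_and gt_eqF// subr_gt0.
tfae.
- move=> [f /strictly_pseudocontractiveP hf].
  have [P hP fP] := posdefmx_of_dot f; exists P; split=> //.
  exact/(loewner_pseudocontractiveP _ _ hP fP).
- move=> [P [hP hA]]; have [f fP] := dot_of_posdefmx hP; exists f.
  apply/nonexpansiveP/nonexpansive_affineP => //.
  exact/(loewner_pseudocontractiveP _ _ hP fP).
- move=> [f /nonexpansiveP hf] rho z ez.
  have := nonexpansive_eigenvalue hf; have := nonexpansive_ascent hf.
  rewrite complexmx_affine => asc eig; split.
    by apply/(in_diskE hkappa); apply: eig; rewrite eigenvalue_affine.
  move=> /(on_disk_boundaryE hkappa) z1; apply/semisimpleP.
  by apply/(ascent_le1_affine _ kappa%:C%C _ kC)/asc.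
- move=> hz alpha Aalpha; split; first by apply/andP; split; rewrite /alpha; nra.
  pose B := kappa%:M + (1 - kappa) *: A; pose W := (complexmx B)^T.
  have WE := complexmx_affine A kappa (1 - kappa).
  (* [nu] inverts the affine map of the disks and carries eigenvalues of [B] back to those of
     [A]. *)
  pose nu (w : R[i]) := (w - kappa%:C%C) / (1 - kappa)%:C%C.
  have nuK w : w = kappa%:C%C + (1 - kappa)%:C%C * nu w.
    by rewrite /nu mulrCA mulfV// mulr1 addrC subrK.
  have [w|w w1|Q uQ hQ] := @sim_contraction _ _ W.
  + by rewrite [w]nuK /W WE eigenvalue_affine// => /hz[/(in_diskE hkappa)].
  (* The kernel condition is required at every point of the circle, whereas [hz] speaks of
     eigenvalues only; elsewhere [W - w] is invertible. *)
  + case: (boolP (eigenvalue W w)) => [|].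
      rewrite {1 2}[w]nuK /W WE eigenvalue_affine// => /hz[_ ss].
      apply/(ascent_le1_affine _ _ _ kC)/semisimpleP/ss.
      by apply/(on_disk_boundaryE hkappa); rewrite -nuK.
    rewrite eigenvalue_unitmx negbK => uW u u0.
    by apply: (can_inj (mulmxK uW)); rewrite u0 mul0mx.
  have [P hP PQ] := posdefmx_of_complex_unit uQ.
  have [f fP] := dot_of_posdefmx hP; exists f.
  apply/averagedP/nonexpansive_affineP => // x; rewrite !fP !PQ.
  have -> : map_mx (real_complex R) (B *m x)^T = map_mx (real_complex R) x^T *m W.
    by rewrite trmx_mul map_mxM /W /complexmx map_trmx.
  exact: hQ.
- move=> [_ [f /(averagedP _ _ hkappa heta) hf]]; exists f.
  exact/strictly_pseudocontractiveP.
Qed.
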